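(* Let $p \neq 2$ be a prime and let $e \ge 1$ be an integer. Let $g \in \mathbb{Z}$ be fixed with $p \nmid g$, and let $m$ be the multiplicative order of $g$ modulo $p$. Then there are exactly $m$ solutions to the congruence $$g^x \equiv x \pmod{p^e}$$ with $x \in \{1, 2, \ldots, p^e m\}$. Furthermore, these solutions are all distinct modulo $p^e$ and all distinct modulo $m$. *)

(* Defs.v *)
From mathcomp Require Import all_boot all_order all_algebra all_fingroup.

Set Implicit Arguments.
Unset Strict Implicit.
Unset Printing Implicit Defensive.

Import GRing.Theory.
Local Open Scope ring_scope.

(* Order of the class of g in the unit group of 'F_p. This is meaningful only
   for p prime and p not dividing g: if p divides g, then insubd returns its
   default, the trivial unit. *)
Definition mult_order (p : nat) (g : int) : nat :=
  #[insubd (1%g : {unit 'F_p}) (g%:~R : 'F_p)]%g.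

(* The solutions x of g ^ x = x modulo n with 1 <= x <= N; the ordinal type
   'I_N.+1 ranges over 0, ..., N. *)
Definition solutions (g : int) (n N : nat) : {set 'I_N.+1} :=
  [set x : 'I_N.+1 | (1 <= x)%N && (g ^+ x == x%:Z %[mod n%:Z])%Z].

(* Main.v *)
Require Import Defs.
From mathcomp Require Import all_boot all_order all_algebra all_fingroup.
From mathcomp Require Import cyclic.

(** The exponential [x |-> h ^ x] contracts the [p]-adic distance: since
    [h ^ m = 1] modulo [p], two exponents that agree modulo [m] and modulo
    [p ^ k] have powers that agree modulo [p ^ k.+1] ([expn_contract]).  So, in
    a fixed residue class modulo [m], the equation [h ^ x = x] is a fixed-point
    equation for a contraction.  Iterating it, with the Chinese remainder
    theorem to stay in the class, yields a solution modulo [p ^ e]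
    ([fixpoint_exists]); and two solutions in one class agree modulo [1], hence
    modulo [p], [p ^ 2], and so on up to [p ^ e] ([fixpoint_unique]).  Thus,
    modulo [p ^ e * m], each of the [m] classes contains exactly one solution,
    which gives both the count and the distinctness modulo [m].

    For the distinctness modulo [p ^ e], if two solutions agree modulo [p ^ e],
    then so do their powers of [h], hence [h ^ x = h ^ y] modulo [p] and the
    exponents also agree modulo [m].

    The powers of the integer [g] depend only on its residue, so the argument
    takes place in the natural numbers, with [h] the remainder of [g] modulo
    [p ^ e]. *)

Set Implicit Arguments.
Unset Strict Implicit.
Unset Printing Implicit Defensive.

Import GRing.Theory.
Local Open Scope ring_scope.

(** In [a ^ p - 1 = (a - 1) * (1 + a + ... + a ^ (p - 1))], the second factor
    consists of [p] terms that are all [1] modulo [p]; so each [p]-th power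
    gains one factor [p]. *)
Lemma dvdn_pred_exp_pow (p k a : nat) :
  (0 < a)%N -> (p %| a.-1)%N -> (p ^ k.+1 %| (a ^ (p ^ k)).-1)%N.
Proof.
move=> a_gt0 pa1; elim: k => [|k IHk]; first by rewrite expn0 expn1.
rewrite [(p ^ k.+1)%N]expnSr expnM; set b := (a ^ (p ^ k))%N in IHk *.
have b_gt0 : (0 < b)%N by rewrite expn_gt0 a_gt0.
have b1 : (b = 1 %[mod p])%N.
  apply/eqP; rewrite eqn_mod_dvd // subn1.
  by apply: dvdn_trans IHk; rewrite expnS dvdn_mulr.
rewrite predn_exp expnSr dvdn_mul // /dvdn -modn_summ.
rewrite (eq_bigr (fun=> 1 %% p)%N) => [|i _]; last by rewrite -modnXm b1 modnXm exp1n.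
by rewrite modn_summ sum1_card card_ord modnn.
Qed.

(** The range [1, ..., N] is a full system of residues modulo [N]. *)
Lemma modn_inj_pos (N x y : nat) :
  (0 < x <= N)%N -> (0 < y <= N)%N -> (x = y %[mod N])%N -> x = y.
Proof.
case: x y => [|x] [|y] //= xN yN /eqP.
by rewrite -(addn1 x) -(addn1 y) eqn_modDr !modn_small // => /eqP->.
Qed.

Lemma modn_pos_repr (N x : nat) :
  (0 < N)%N -> exists2 y, (0 < y <= N)%N & (y = x %[mod N])%N.
Proof.
(* subtracting 1 before the reduction sends the residue 0 to N *)
move=> N_gt0; exists ((x + N.-1) %% N).+1; first by rewrite ltn_pmod.
by rewrite -addn1 modnDml -addnA addn1 prednK // modnDr.
Qed.

Section ExponentialFixpoints.

Variables (p m h : nat).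
Hypothesis p_gt0 : (0 < p)%N.
Hypothesis h_gt0 : (0 < h)%N.
Hypothesis m_gt0 : (0 < m)%N.
Hypothesis co_pm : coprime p m.
(* [m] is the order of [h] modulo [p] *)
Hypothesis orderP :
  forall x y, (h ^ x == h ^ y %[mod p])%N = (x == y %[mod m])%N.

Lemma eq_mod_pow_mul (k x y : nat) :
  (x == y %[mod p ^ k * m])%N = (x == y %[mod p ^ k])%N && (x == y %[mod m])%N.
Proof. by rewrite chinese_remainder // coprimeXl. Qed.

(** The exponents differ by a multiple of [p ^ k * m], and [h ^ m] is [1]
    modulo [p], so its [p ^ k]-th power is [1] modulo [p ^ k.+1]. *)
Lemma expn_contract (k x y : nat) :
  (x = y %[mod p ^ k])%N -> (x = y %[mod m])%N ->
  (h ^ x = h ^ y %[mod p ^ k.+1])%N.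
Proof.
wlog le_yx : x y / (y <= x)%N => [IH xyp xym|].
  by case/orP: (leq_total y x) => le; [exact: IH | symmetry; apply: IH].
move=> /eqP xyp /eqP xym; have := eq_mod_pow_mul k x y.
rewrite xyp xym eqn_mod_dvd // => /dvdnP[c xy].
have hc1 : (h ^ (c * m) = 1 %[mod p])%N.
  by apply/eqP; rewrite -[X in (_ == X %[mod _])%N](expn0 h) orderP modnMl mod0n.
suff hxy1 : (h ^ (x - y) = 1 %[mod p ^ k.+1])%N.
  by rewrite -(subnK le_yx) expnD -modnMml hxy1 modnMml mul1n.
apply/eqP; rewrite xy mulnCA mulnC expnM eqn_mod_dvd ?expn_gt0 ?h_gt0 // subn1.
apply: dvdn_pred_exp_pow; first by rewrite expn_gt0 h_gt0.
by rewrite -subn1 -eqn_mod_dvd ?expn_gt0 ?h_gt0 ?hc1.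
Qed.

Lemma eq_mod_pow_le (j k x y : nat) :
  (j <= k)%N -> (x = y %[mod p ^ k])%N -> (x = y %[mod p ^ j])%N.
Proof.
by move=> le_jk xy; rewrite -(modn_dvdm x (dvdn_exp2l p le_jk)) xy modn_dvdm ?dvdn_exp2l.
Qed.

(** For solutions, a congruence between [h ^ x] and [h ^ y] is one between [x]
    and [y], so each contraction gains a factor [p], up to the modulus [p ^ e]
    in which [x] and [y] are solutions. *)
Lemma fixpoint_unique (e x y : nat) :
  (h ^ x = x %[mod p ^ e])%N -> (h ^ y = y %[mod p ^ e])%N ->
  (x = y %[mod m])%N -> (x = y %[mod p ^ e])%N.
Proof.
move=> fx fy xym; suff: forall k, (k <= e)%N -> (x = y %[mod p ^ k])%N by exact.
elim=> [_|k IHk lt_ke]; first by rewrite !modn1.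
rewrite -(eq_mod_pow_le lt_ke fx) -(eq_mod_pow_le lt_ke fy).
by apply: expn_contract xym; apply/IHk/ltnW.
Qed.

(** If [x] is a solution modulo [p ^ k], then [y = h ^ x] modulo [p ^ k.+1] still
    agrees with [x] modulo [p ^ k], so [h ^ y = h ^ x = y] modulo [p ^ k.+1],
    provided that [y] is kept in the class of [x] modulo [m]. *)
Lemma fixpoint_exists (e r : nat) :
  exists2 x, (h ^ x = x %[mod p ^ e])%N & (x = r %[mod m])%N.
Proof.
elim: e => [|k [x fx xr]]; first by exists r; rewrite ?modn1.
have co : coprime (p ^ k.+1) m by rewrite coprimeXl.
pose y := chinese (p ^ k.+1) m (h ^ x) r.
have yp : (y = h ^ x %[mod p ^ k.+1])%N by apply: chinese_modl.
have yr : (y = r %[mod m])%N by apply: chinese_modr.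
exists y => //; rewrite yp; apply: expn_contract; last by rewrite yr.
by rewrite (eq_mod_pow_le (leqnSn k) yp).
Qed.

(** [h ^ x] modulo [p ^ e] depends only on [x] modulo [p ^ e * m], so the
    solution can be moved into the prescribed range. *)
Lemma fixpoint_exists_range (e r : nat) :
  exists x, [/\ (0 < x <= p ^ e * m)%N, (h ^ x = x %[mod p ^ e])%N
              & (x = r %[mod m])%N].
Proof.
have [x fx xr] := fixpoint_exists e r.
have N_gt0 : (0 < p ^ e * m)%N by rewrite muln_gt0 expn_gt0 p_gt0.
have [y y_range /eqP] := modn_pos_repr x N_gt0.
rewrite eq_mod_pow_mul => /andP[/eqP yxp /eqP yxm]; exists y.
split=> //; last by rewrite yxm.
by rewrite yxp -fx; apply: (eq_mod_pow_le (leqnSn e)); apply: expn_contract.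
Qed.

Lemma fixpoint_eq_mod_order (e x y : nat) : (0 < e)%N ->
  (h ^ x = x %[mod p ^ e])%N -> (h ^ y = y %[mod p ^ e])%N ->
  (x = y %[mod p ^ e])%N -> (x = y %[mod m])%N.
Proof.
move=> e_gt0 fx fy xy; apply/eqP; rewrite -orderP -[p]expn1; apply/eqP.
by apply: (eq_mod_pow_le e_gt0); rewrite fx fy.
Qed.

End ExponentialFixpoints.

(** Transfers the order of a unit of ['F_p] to congruences between natural
    numbers, the form that the fixed-point lemmas use. *)
Lemma mult_orderP (p : nat) (g : int) (h : nat) :
  prime p -> ~~ (p %| h)%N -> g%:~R = h%:R :> 'F_p ->
  forall x y, (h ^ x == h ^ y %[mod p])%N = (x == y %[mod mult_order p g])%N.
Proof.
move=> p_prime pNh gh x y.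
have eqFp a b : (a%:R == b%:R :> 'F_p) = (a == b %[mod p])%N.
  by rewrite -val_eqE /= !val_Fp_nat.
have h_unit : (g%:~R : 'F_p) \is a GRing.unit.
  by rewrite unitfE gh -[0]/(0%:R) eqFp mod0n.
rewrite /mult_order -eq_expg_mod_order -val_eqE /= !FinRing.val_unitX.
by rewrite insubdK // gh -!natrX eqFp.
Qed.

(** Fermat's little theorem [h ^ p = h] says that [p = 1] modulo the order. *)
Lemma coprime_mult_order (p : nat) (g : int) (h : nat) :
  prime p -> ~~ (p %| h)%N -> g%:~R = h%:R :> 'F_p ->
  coprime p (mult_order p g).
Proof.
move=> p_prime pNh gh.
have /eqP p1 : (p == 1 %[mod mult_order p g])%N.
  rewrite -(mult_orderP p_prime pNh gh) expn1.
  by apply/eqP/fermat_little.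
by rewrite -coprime_modl p1 coprime_modl coprime1n.
Qed.

Theorem corollary9 (p e : nat) (g : int) (m : nat)
    (p_prime : prime p) (p_neq2 : p <> 2%N) (e_ge1 : (1 <= e)%N)
    (p_ndvd_g : ~~ (p%:Z %| g)%Z) (m_def : m = mult_order p g) :
  let S := solutions g (p ^ e)%N (p ^ e * m)%N in
  [/\ #|S| = m,
      forall x y : 'I_(p ^ e * m).+1, x \in S -> y \in S -> x <> y ->
        (x <> y %[mod p ^ e])%N
    & forall x y : 'I_(p ^ e * m).+1, x \in S -> y \in S -> x <> y ->
        (x <> y %[mod m])%N].
Proof.
move=> S; have p_gt0 := prime_gt0 p_prime.
have pe_neq0 : (p ^ e)%N%:Z != 0 by rewrite -lt0n expn_gt0 p_gt0.
pose h := `|(g %% (p ^ e)%N%:Z)%Z|%N.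
have hE : h%:Z = (g %% (p ^ e)%N%:Z)%Z by rewrite gez0_abs ?modz_ge0.
have dvd_p_pe : (p%:Z %| (p ^ e)%N%:Z)%Z by rewrite dvdzE /= dvdn_exp.
have p_dvd_gh : (p%:Z %| g - h%:Z)%Z.
  rewrite hE {1}(divz_eq g (p ^ e)%N%:Z) addrK.
  exact: dvdz_mull.
have gh : g%:~R = h%:R :> 'F_p.
  case/dvdzP: p_dvd_gh => q gq; apply/eqP.
  rewrite -subr_eq0 -[h%:R]/(h%:Z%:~R) -intrB gq intrM.
  by rewrite -[p%:Z%:~R]/(p%:R) pchar_Fp_0 ?mulr0.
have pNh : ~~ (p %| h)%N.
  apply: contra p_ndvd_g => p_h.
  by rewrite -(subrK h%:Z g); apply: rpredD.
have h_gt0 : (0 < h)%N by case: (h) pNh; rewrite ?dvdn0.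
have m_gt0 : (0 < m)%N by rewrite m_def order_gt0.
have ordP := mult_orderP p_prime pNh gh.
have co_pm := coprime_mult_order p_prime pNh gh.
rewrite -m_def in ordP co_pm.
have inS (x : 'I_(p ^ e * m).+1) :
    reflect ((0 < x)%N /\ (h ^ x = x %[mod p ^ e])%N) (x \in S).
  have powz : (g %% (p ^ e)%N%:Z)%Z ^+ x = (h ^ x)%N%:Z.
    by rewrite -hE -!natz natrX.
  rewrite inE -modzXm powz !modz_nat eqz_nat.
  by apply: (iffP andP) => -[? /eqP].
have rangeS (x : 'I_(p ^ e * m).+1) : x \in S -> (0 < x <= p ^ e * m)%N.
  by case/inS=> -> _; rewrite -ltnS ltn_ord.
have injS (x y : 'I_(p ^ e * m).+1) : x \in S -> y \in S ->
    (x = y %[mod p ^ e])%N -> (x = y %[mod m])%N -> x = y.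
  move=> xS yS xyp xym; apply/val_inj/(modn_inj_pos (rangeS x xS) (rangeS y yS)).
  by apply/eqP; rewrite eq_mod_pow_mul // xyp xym !eqxx.
have injSm (x y : 'I_(p ^ e * m).+1) :
    x \in S -> y \in S -> (x = y %[mod m])%N -> x = y.
  move=> xS yS xym; have [[_ fx] [_ fy]] := (inS x xS, inS y yS).
  by apply: injS => //; apply: (fixpoint_unique (h := h) (m := m)).
split=> [|x y xS yS neq_xy xy|x y xS yS neq_xy xy]; last exact/neq_xy/injSm.
(* reduction modulo m is a bijection from S onto 'I_m *)
- pose f (x : 'I_(p ^ e * m).+1) := Ordinal (ltn_pmod x m_gt0).
  have f_inj : {in S &, injective f}.
    by move=> x y xS yS [xy]; apply: injSm.
  rewrite -(card_in_imset f_inj) -[RHS]card_ord -cardsT; congr #|pred_of_set _|.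
  apply/setP=> r; rewrite inE; apply/imsetP.
  have [x [/andP[x_gt0 x_le] fx xr]] :=
    fixpoint_exists_range p_gt0 h_gt0 m_gt0 co_pm ordP e r.
  exists (Ordinal (x_le : (x < (p ^ e * m).+1)%N)); first exact/inS.
  by apply: val_inj; rewrite /= xr modn_small.
- have [[_ fx] [_ fy]] := (inS x xS, inS y yS).
  by apply/neq_xy/injSm => //; apply: (fixpoint_eq_mod_order ordP e_ge1).
Qed.
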